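(* Let $(G,\cdot)$ be a group, let $H\leq G$ be a subgroup of index $2$, and let $\alpha\in\operatorname{Aut}(G)$ satisfy $\alpha^2=\mathrm{Id}$ and $\alpha(H)=H$. Define $\lambda_a=\mathrm{Id}$ for $a\in H$ and $\lambda_a=\alpha$ for $a\notin H$. Then $a\bullet b:=a\cdot\lambda_a(b)$ defines a skew brace $(G,\cdot,\bullet)$, whose $\star$-product is given by $a\star b=1$ if $a\in H$ and $a\star b=\alpha(b)\cdot b^{-1}$ if $a\notin H$. Put $\Delta:=\{\alpha(c)\cdot c^{-1}\mid c\in G\}$. Then $\Delta\subseteq H$, and the following hold: 1) $\star$ is associative if and only if $\Delta\subseteq\operatorname{Fix}(\alpha)$, if and only if $d^2=1$ for every $d\in\Delta$. In this case all triple $\star$-products are trivial, i.e. $(a\star b)\star c=a\star(b\star c)=1$ for all $a,b,c\in G$. 2) The skew brace is two-sided if and only if $b^{-1}\cdot d\cdot b=d$ for all $d\in\Delta$, $b\in H$, and $b^{-1}\cdot d\cdot b=d^{-1}$ for all $d\in\Delta$, $b\notin H$. In particular, when $\star$ is associative, two-sidedness is equivalent to $\Delta\subseteq Z(G)$.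
   Context: A skew brace is a triple $(A,\cdot,\bullet)$ where $(A,\cdot)$ and $(A,\bullet)$ are groups with the same identity $1$ such that $a\bullet(b\cdot c)=(a\bullet b)\cdot a^{-1}\cdot(a\bullet c)$ for all $a,b,c\in A$, where $a^{-1}$ denotes the inverse of $a$ in $(A,\cdot)$. It is two-sided if in addition $(a\cdot b)\bullet c=(a\bullet c)\cdot c^{-1}\cdot(b\bullet c)$ for all $a,b,c\in A$. The $\star$-product is $a\star b:=a^{-1}\cdot(a\bullet b)\cdot b^{-1}$. $\operatorname{Fix}(\alpha)$ is the set of elements of $G$ fixed by $\alpha$, and $Z(G)$ is the center of $(G,\cdot)$. *)

(* Defs.v *)
From HB Require Import structures.
From mathcomp Require Import all_boot.
From mathcomp Require Import boolp classical_sets functions cardinality.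

Set Implicit Arguments.
Unset Strict Implicit.
Unset Printing Implicit Defensive.

Local Open Scope classical_set_scope.
Local Open Scope group_scope.

(* Groups are arbitrary (possibly infinite) [groupType]s, and subsets are
   classical [set]s, so that membership [x \in H] is decided classically. *)

Definition is_subgroup (G : groupType) (H : set G) : Prop :=
  group_closed (mem H).

Definition left_cosets (G : groupType) (H : set G) : set (set G) :=
  [set [set a * h | h in H] | a in [set: G]].

Definition has_index (G : groupType) (H : set G) (n : nat) : Prop :=
  (left_cosets H #= `I_n)%card.

Definition center (G : groupType) : set G :=
  [set z | forall g : G, commute z g].

Arguments center G : clear implicits.

Definition Fix (T : Type) (f : T -> T) : set T := [set x | f x = x].

Definition is_group_law (T : Type) (e : T) (op : T -> T -> T) : Prop :=
  [/\ associative op, left_id e op, right_id e op &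
      forall x : T, exists y : T, op x y = e /\ op y x = e].

(* [A] carries the first group structure; [circ] is the second operation,
   required to be a group law with the same identity element [1]. *)
Definition is_skew_brace (A : groupType) (circ : A -> A -> A) : Prop :=
  is_group_law 1 circ /\
  forall a b c : A, circ a (b * c) = circ a b * a^-1 * circ a c.

Definition is_two_sided_skew_brace (A : groupType) (circ : A -> A -> A)
    : Prop :=
  is_skew_brace circ /\
  forall a b c : A, circ (a * b) c = circ a c * c^-1 * circ b c.

Definition star (A : groupType) (circ : A -> A -> A) (a b : A) : A :=
  a^-1 * circ a b * b^-1.

Definition lambda (G : groupType) (H : set G) (alpha : G -> G) (a : G)
    : G -> G :=
  if a \in H then id else alpha.

Definition bullet (G : groupType) (H : set G) (alpha : G -> G) (a b : G) : G :=
  a * lambda H alpha a b.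

Definition Delta (G : groupType) (alpha : G -> G) : set G :=
  [set alpha c * c^-1 | c in [set: G]].

(* Main.v *)
Require Import Defs.
From HB Require Import structures.
From mathcomp Require Import all_boot.
From mathcomp Require Import boolp classical_sets functions cardinality.

Local Open Scope classical_set_scope.
Local Open Scope group_scope.

(** Index 2 enters through two facts: some element lies outside [H]
    ([index2_exists_notin]), and the product [a * b] lies in [H] exactly when
    [a] and [b] are both in [H] or both outside it ([mem_mulg_index2]). As
    [alpha] is an involution, this parity rule makes [a |-> lambda_a] a
    homomorphism from [G] to the automorphisms of [G] ([lambdaM]). As [alpha]
    preserves [H], the element [a * lambda_a b] has the same parity as
    [a * b], so that [lambda_(a * lambda_a b) = lambda_a \o lambda_b]. This
    is the condition under which a family of automorphisms defines a skew
    brace ([gamma_skew_brace]), and the star product is then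
    [lambda_a b * b^-1].

    The set [Delta] lies in [H] by parity, so [star (star a b) c] is always
    trivial ([star_starl]), and associativity says that [star a (star b c)]
    is trivial too. For [a] and [b] outside [H] and [d = alpha c * c^-1] this
    reads [alpha d = d]; since [alpha d = d^-1] ([alpha_Delta]), it amounts
    to [d ^+ 2 = 1].

    For two-sidedness, the right distributivity law at [a], [b], [c] is a
    tautology when [a] lies in [H]. When [a] does not, write
    [alpha c = d * c] and cancel [a] on the left and [c] on the right: the
    law becomes [b * d = d * b] if [b] is in [H] and [b = d * b * d]
    otherwise. These are the two conjugation conditions. If moreover
    [d^-1 = d], both say that [b] commutes with [d]. *)

(** * Subgroups of index two *)

Section IndexTwo.

Variables (G : groupType) (H : set G).
Hypotheses (H_subgroup : is_subgroup H) (H_index2 : has_index H 2).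

Lemma index2_exists_notin : exists a : G, a \notin H.
Proof.
apply: contrapT => noH.
have HT : H = setT.
  apply/seteqP; split=> // x _; rewrite -in_setE.
  by apply: contrapT => /negP xH; apply: noH; exists x.
have cosetT X : left_cosets H X -> X = setT.
  case=> a _ <-; apply/seteqP; split=> // x _.
  by exists (a^-1 * x); rewrite ?HT ?mulVKg.
have /eq_cardSP [X /cosetT XT] := H_index2.
by case/eq_cardSP=> Y [/cosetT YT []]; rewrite XT YT.
Qed.

(** The case that needs index 2 is that of [a] and [b] both outside [H]: the
    cosets of [a^-1] and of [b] then both differ from that of [1], hence they
    coincide, and comparing the representatives gives [a * b \in H]. *)
Lemma mem_mulg_index2 (a b : G) : (a * b \in H) = ((a \in H) == (b \in H)).
Proof.
have [H1 _] := H_subgroup.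
have HV (x : G) : x \in H -> x^-1 \in H by exact: (group_closedV H_subgroup).
have HM (x y : G) : x \in H -> y \in H -> x * y \in H.
  by move=> xH yH; exact: (group_closedM H_subgroup).
have mem1l (x y : G) : x \in H -> (x * y \in H) = (y \in H).
  move=> xH; apply/idP/idP; last exact: HM.
  by rewrite -{2}(mulKg x y); apply: HM; exact: HV.
have mem1r (x y : G) : y \in H -> (x * y \in H) = (x \in H).
  move=> yH; apply/idP/idP=> [xyH|xH]; last exact: HM.
  by rewrite -(mulgK y x); apply: HM => //; exact: HV.
have [aH|aH] := boolP (a \in H); first by rewrite mem1l.
have [bH|bH] := boolP (b \in H); first by rewrite mem1r // (negbTE aH).
pose K (x : G) := [set x * h | h in H].
have LK x : left_cosets H (K x) by exists x.
have KE x y : K x = K y -> x^-1 * y \in H.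
  move=> Kxy; have : K y y by exists 1; rewrite ?mulg1 // -in_setE.
  by rewrite -Kxy => -[h hH <-]; rewrite mulKg in_setE.
have aVH : a^-1 \notin H by apply: contra aH => /HV; rewrite invgK.
have /eq_cardSP [X LX] := H_index2.
case/eq_cardSP=> Y LY; rewrite II0 card_eq0 => /eqP LXY.
have two x : K x = X \/ K x = Y.
  apply: contrapT => /not_orP [nX nY].
  have : set0 (K x) by rewrite -LXY; split=> //; split.
  by [].
have K1 x : x \notin H -> K 1 <> K x.
  by move=> xH /KE; rewrite invg1 mul1g (negbTE xH).
have : K a^-1 = K b.
  have := K1 _ aVH; have := K1 _ bH.
  by case: (two 1) => ->; case: (two a^-1) => ->; case: (two b) => ->.
by move/KE; rewrite invgK eqxx.
Qed.

End IndexTwo.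

(** * Multiplicative maps between groups *)

Lemma multiplicative1 (G K : groupType) (f : {multiplicative G -> K}) : f 1 = 1.
Proof. by apply: (mulgI (f 1)); rewrite -gmulfM !mulg1. Qed.

Lemma multiplicativeV (G K : groupType) (f : {multiplicative G -> K}) (x : G) :
  f x^-1 = (f x)^-1.
Proof. by apply: (mulgI (f x)); rewrite -gmulfM !mulgV multiplicative1. Qed.

(** * Skew braces from families of automorphisms *)

(** The compatibility of [gamma] with the new operation says that [gamma] is a
    homomorphism from the new group to [Aut G]; this gives associativity, and
    together with surjectivity it gives inverses: if [gamma a y = a^-1], then
    [y] is a right inverse of [a], and applying [gamma a] to the product of
    [y] and [a] shows that it is also a left one. *)
Lemma gamma_skew_brace (G : groupType) (gamma : G -> G -> G) :
    (forall a, {morph gamma a : x y / x * y}) ->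
    (forall a, bijective (gamma a)) ->
    (forall a b c, gamma (a * gamma a b) c = gamma a (gamma b c)) ->
  is_skew_brace (fun a b => a * gamma a b).
Proof.
move=> gM gB gA.
have g_inj a : injective (gamma a) := bij_inj (gB a).
have g1r a : gamma a 1 = 1.
  by apply: (mulgI (gamma a 1)); rewrite -gM !mulg1.
have g1l a : gamma 1 a = a by apply: (g_inj 1); rewrite -gA mul1g g1r.
split; last by move=> a b c; rewrite gM !mulgA mulgVK.
split=> [a b c | a | a | a].
- by rewrite gA gM mulgA.
- by rewrite g1l mul1g.
- by rewrite g1r mulg1.
have [g' _ gK] := gB a; exists (g' a^-1); rewrite gK mulgV; split=> //.
by apply: (g_inj a); rewrite gM -gA gK mulgV g1l mulVg g1r.
Qed.

(** * The skew brace of an involution preserving a subgroup of index two *)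

Section Involution.

Variables (G : groupType) (H : set G) (alpha : {multiplicative G -> G}).
Hypothesis memM : forall a b : G, (a * b \in H) = ((a \in H) == (b \in H)).
Hypothesis alphaK : involutive alpha.
Hypothesis alpha_mem : forall a : G, (alpha a \in H) = (a \in H).

Notation circ := (bullet H alpha).
Notation st := (star circ).
Notation D := (Delta alpha).

Lemma lambda_in (a b : G) : a \in H -> lambda H alpha a b = b.
Proof. by rewrite /lambda => ->. Qed.

Lemma lambda_notin (a b : G) : a \notin H -> lambda H alpha a b = alpha b.
Proof. by rewrite /lambda => /negbTE ->. Qed.

Lemma lambda_mem (a b : G) : (lambda H alpha a b \in H) = (b \in H).
Proof. by rewrite /lambda; case: ifP. Qed.

Lemma lambdaM (a b c : G) :
  lambda H alpha (a * b) c = lambda H alpha a (lambda H alpha b c).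
Proof.
by rewrite /lambda memM; case: (a \in H); case: (b \in H); rewrite //= alphaK.
Qed.

Lemma lambda_eq_mem (a b c : G) : (a \in H) = (b \in H) ->
  lambda H alpha a c = lambda H alpha b c.
Proof. by rewrite /lambda => ->. Qed.

Lemma bullet_skew_brace : is_skew_brace circ.
Proof.
apply: gamma_skew_brace => [a x y | a | a b c].
- by rewrite /lambda; case: ifP => // _; exact: gmulfM.
- exists (lambda H alpha a) => x; rewrite /lambda;
    by case: ifP => // _; exact: alphaK.
- by rewrite -lambdaM; apply: lambda_eq_mem; rewrite !memM lambda_mem.
Qed.

Lemma starE (a b : G) : st a b = lambda H alpha a b * b^-1.
Proof. by rewrite /star /bullet mulKg. Qed.

Lemma star_in (a b : G) : a \in H -> st a b = 1.
Proof. by move=> aH; rewrite starE lambda_in // mulgV. Qed.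

Lemma star_notin (a b : G) : a \notin H -> st a b = alpha b * b^-1.
Proof. by move=> aH; rewrite starE lambda_notin. Qed.

Lemma star1 (a : G) : st a 1 = 1.
Proof.
by rewrite starE /lambda; case: ifP; rewrite /= ?multiplicative1 mulgV.
Qed.

Lemma DeltaI (c : G) : D (alpha c * c^-1).
Proof. by exists c. Qed.

Lemma mem1 : 1 \in H.
Proof. by have := memM 1 1; rewrite mul1g eqxx. Qed.

Lemma memV (a : G) : (a^-1 \in H) = (a \in H).
Proof. by apply/esym/eqP; rewrite -memM mulgV mem1. Qed.

Lemma Delta_sub : D `<=` H.
Proof.
by move=> _ [c _ <-]; rewrite -in_setE memM alpha_mem memV eqxx.
Qed.

(** The involution exchanges [alpha c] and [c], hence inverts their quotient. *)
Lemma alpha_Delta (d : G) : D d -> alpha d = d^-1.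
Proof. by case=> c _ <-; rewrite gmulfM multiplicativeV alphaK invgF. Qed.

(** Every star product lies in [H], where [lambda] is trivial. *)
Lemma star_starl (a b c : G) : st (st a b) c = 1.
Proof.
apply: star_in; have [aH|aH] := boolP (a \in H).
  by rewrite star_in // mem1.
by rewrite star_notin // in_setE; exact/Delta_sub/DeltaI.
Qed.

Lemma Delta_fix_star_starr (a b c : G) :
  D `<=` Fix alpha -> st a (st b c) = 1.
Proof.
move=> DF; have [aH|aH] := boolP (a \in H); first exact: star_in.
have [bH|bH] := boolP (b \in H); first by rewrite (star_in _ _ bH) star1.
by rewrite !star_notin // (DF _ (DeltaI c)) mulgV.
Qed.

Lemma star_assoc_fix : (exists a : G, a \notin H) ->
  associative st <-> D `<=` Fix alpha.
Proof.
move=> [a aH]; split=> [stA _ [c _ <-] | DF x y z]; last first.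
  by rewrite star_starl Delta_fix_star_starr.
apply: divg1_eq; have := stA a a c.
by rewrite star_starl (star_notin a c) // star_notin.
Qed.

Lemma Delta_fixE (d : G) : D d -> Fix alpha d <-> d ^+ 2 = 1.
Proof.
move=> Dd; rewrite /Fix /= alpha_Delta // expg2; split=> [{1}<-|/mulg1_eq//].
by rewrite mulVg.
Qed.

Lemma Delta_fix_sqr1 : D `<=` Fix alpha <-> (forall d, d \in D -> d ^+ 2 = 1).
Proof.
split=> [DF d | D2 d Dd]; first by rewrite in_setE => Dd; apply/Delta_fixE/DF.
by apply/Delta_fixE => //; apply: D2; rewrite in_setE.
Qed.

Definition right_distr (a b c : G) : Prop :=
  circ (a * b) c = circ a c * c^-1 * circ b c.

Lemma right_distr_in (a b c : G) : a \in H -> right_distr a b c.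
Proof.
by move=> aH; rewrite /right_distr /bullet lambdaM !(lambda_in a) // mulgK mulgA.
Qed.

(** Here [lambda_(a * b) = lambda_a = alpha] while [lambda_b] is trivial, so
    with [alpha c = d * c] the law reads [a * b * (d * c) = a * d * (b * c)]. *)
Lemma right_distr_notin_in (a b c : G) : a \notin H -> b \in H ->
  right_distr a b c <->
  b^-1 * (alpha c * c^-1) * b = alpha c * c^-1.
Proof.
move=> aH bH; rewrite /right_distr /bullet lambdaM !(lambda_in b) //.
rewrite !lambda_notin //; set d := alpha c * c^-1.
have -> : a * b * alpha c = a * (b * d) * c by rewrite /d !mulgA mulgVK.
have -> : a * alpha c * c^-1 * (b * c) = a * (d * b) * c by rewrite /d !mulgA.
split=> [/mulIg/mulgI bd|dE]; first by rewrite -mulgA -bd mulKg.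
by rewrite -{1}dE -!mulgA mulVKg.
Qed.

(** Here [lambda_(a * b)] is trivial while [lambda_a = lambda_b = alpha], so
    with [alpha c = d * c] the law reads [a * b * c = a * d * (b * d * c)]. *)
Lemma right_distr_notin_notin (a b c : G) : a \notin H -> b \notin H ->
  right_distr a b c <->
  b^-1 * (alpha c * c^-1) * b = (alpha c * c^-1)^-1.
Proof.
move=> aH bH; rewrite /right_distr /bullet lambdaM !lambda_notin // alphaK.
set d := alpha c * c^-1.
have -> : a * alpha c * c^-1 * (b * alpha c) = a * (d * b * d) * c.
  by rewrite /d !mulgA mulgVK.
move: d => d; split=> [/mulIg/mulgI bE|dE].
  by apply: divg1_eq; rewrite invgK -!mulgA (mulgA d) -bE mulVg.
congr (_ * _); congr (_ * _).
by rewrite -(mulVKg b (d * b)) (mulgA _ d) dE mulgVK.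
Qed.

Lemma two_sided_conj : (exists a : G, a \notin H) ->
  is_two_sided_skew_brace circ <->
    (forall d b : G, d \in D -> b \in H -> b^-1 * d * b = d) /\
    (forall d b : G, d \in D -> b \notin H -> b^-1 * d * b = d^-1).
Proof.
move=> [a aH]; split=> [[_ distr] | [DH DN]].
  split=> d b; rewrite in_setE => -[c _ <-] bH.
  - by apply: (iffLR (right_distr_notin_in _ _ c aH bH)); exact: distr.
  - by apply: (iffLR (right_distr_notin_notin _ _ c aH bH)); exact: distr.
split=> [|x y z]; first exact: bullet_skew_brace.
have zD : alpha z * z^-1 \in D by rewrite in_setE; exact: DeltaI.
have [xH|xH] := boolP (x \in H); first exact: right_distr_in.
have [yH|yH] := boolP (y \in H).
- by apply/right_distr_notin_in => //; exact: DH.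
- by apply/right_distr_notin_notin => //; exact: DN.
Qed.

Lemma conj_centralE : D `<=` Fix alpha ->
  ((forall d b : G, d \in D -> b \in H -> b^-1 * d * b = d) /\
   (forall d b : G, d \in D -> b \notin H -> b^-1 * d * b = d^-1)) <->
  D `<=` center G.
Proof.
move=> DF; have DV d : d \in D -> d^-1 = d.
  by rewrite in_setE => Dd; rewrite -alpha_Delta //; exact: DF.
have conjE (d b : G) : b^-1 * d * b = d <-> commute d b.
  split=> [dE|db]; last by rewrite -mulgA db mulKg.
  by rewrite /commute -{2}dE -!mulgA mulVKg.
split=> [[DH DN] d Dd b | DZ].
  have dD : d \in D by rewrite in_setE.
  apply/conjE; have [bH|bH] := boolP (b \in H); first exact: DH.
  by rewrite DN // DV.
split=> d b dD _; have /conjE -> // : commute d b.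
  by apply: DZ; rewrite -in_setE.
- by apply: DZ; rewrite -in_setE.
by rewrite DV.
Qed.

End Involution.

(** * The skew brace defined by an involution and a subgroup of index two *)

Theorem proposition3p12 (G : groupType) (H : set G)
    (alpha : {multiplicative G -> G})
    (H_subgroup : is_subgroup H) (H_index2 : has_index H 2)
    (alpha_bij : bijective alpha) (alpha_invol : alpha \o alpha = id)
    (alphaH : alpha @` H = H) :
  let circ := bullet H alpha in
  let st := star circ in
  let D := Delta alpha in
  is_skew_brace circ /\
  (forall a b : G, a \in H -> st a b = 1) /\
  (forall a b : G, a \notin H -> st a b = alpha b * b^-1) /\
  D `<=` H /\
  (associative st <-> D `<=` Fix alpha) /\
  (D `<=` Fix alpha <-> (forall d : G, d \in D -> d ^+ 2 = 1)) /\
  (associative st ->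
     forall a b c : G, st (st a b) c = 1 /\ st a (st b c) = 1) /\
  (is_two_sided_skew_brace circ <->
     (forall d b : G, d \in D -> b \in H -> b^-1 * d * b = d) /\
     (forall d b : G, d \in D -> b \notin H -> b^-1 * d * b = d^-1)) /\
  (associative st -> (is_two_sided_skew_brace circ <-> D `<=` center G)).
Proof.
move=> circ st D.
have memM := mem_mulg_index2 _ _ H_subgroup H_index2.
have exN := index2_exists_notin _ _ H_index2.
have alphaK : involutive alpha by move=> x; exact: (congr1 (@^~ x) alpha_invol).
have alpha_mem (a : G) : (alpha a \in H) = (a \in H).
  have alphaHH (x : G) : x \in H -> alpha x \in H.
    by rewrite !in_setE => Hx; rewrite -alphaH; exists x.
  by apply/idP/idP=> [/alphaHH|/alphaHH//]; rewrite alphaK.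
have assocE := star_assoc_fix _ _ _ memM alpha_mem exN.
have twoE := two_sided_conj _ _ _ memM alphaK alpha_mem exN.
split; first exact: bullet_skew_brace.
split; first by move=> a b; exact: star_in.
split; first by move=> a b; exact: star_notin.
split; first exact: Delta_sub.
split=> //.
split; first exact: Delta_fix_sqr1.
split=> [/assocE DF a b c|].
  by split; [exact: star_starl | exact: Delta_fix_star_starr].
split=> // /assocE DF; apply: (iff_trans twoE).
exact: (conj_centralE _ _ _ alphaK DF).
Qed.
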